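(* Let $r>0$ and let $f:C^0([-r,0];\mathbb{R}^n)\to\mathbb{R}^n$ satisfy $f(0)=0$ and be Lipschitz on bounded sets of $C^0([-r,0];\mathbb{R}^n)$. For the time-delay system $\dot x(t)=f(x_t)$, the properties (GAS) and (RFC) both hold if and only if the property (UGAS) holds.
   Context: $|\cdot|$ is the Euclidean norm on $\mathbb{R}^n$ and $\mathbb{R}_+=[0,+\infty)$. $C^0([-r,0];\mathbb{R}^n)$ is the space of continuous functions with norm $\|x\|_\infty=\max_{s\in[-r,0]}|x(s)|$. $f$ is Lipschitz on bounded sets of $C^0([-r,0];\mathbb{R}^n)$ if there is a non-decreasing function $L:\mathbb{R}_+\to\mathbb{R}_+$ such that for every $R\ge 0$, $|f(x)-f(y)|\le L(R)\|x-y\|_\infty$ for all $x,y$ with $\|x\|_\infty\le R$, $\|y\|_\infty\le R$. For the system $\dot x(t)=f(x_t)$, $x(t)\in\mathbb{R}^n$ and $x_t\in C^0([-r,0];\mathbb{R}^n)$ is defined by $x_t(s)=x(t+s)$, $s\in[-r,0]$. For $x_0\in C^0([-r,0];\mathbb{R}^n)$, $\phi(t,x_0)$ denotes $x_t$, where $x(t)$ is the (unique, maximally defined for $t\ge0$) solution with initial condition $x_0$. Every property below that involves $\phi(t,x_0)$ for given times $t$ is understood to include existence of the solution at those times. Class $K$: strictly increasing continuous functions $\rho:\mathbb{R}_+\to\mathbb{R}_+$ with $\rho(0)=0$. Class $KL$: functions $\sigma:\mathbb{R}_+\times\mathbb{R}_+\to\mathbb{R}_+$ such that $\sigma(\cdot,t)$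 is of class $K$ for each $t\ge0$, and $\sigma(s,\cdot)$ is non-increasing with $\lim_{t\to+\infty}\sigma(s,t)=0$ for each $s\ge0$. (LS): for every $\varepsilon>0$ there exists $\delta(\varepsilon)>0$ such that $\sup\{\|\phi(t,x_0)\|_\infty: t\ge0,\ x_0\in C^0([-r,0];\mathbb{R}^n),\ \|x_0\|_\infty\le\delta(\varepsilon)\}\le\varepsilon$. (GA): for every $x_0\in C^0([-r,0];\mathbb{R}^n)$, $\lim_{t\to+\infty}\|\phi(t,x_0)\|_\infty=0$. (GAS): both (LS) and (GA) hold. (RFC): for every $\rho,T>0$, $\sup\{\|\phi(t,x_0)\|_\infty: t\in[0,T],\ x_0\in C^0([-r,0];\mathbb{R}^n),\ \|x_0\|_\infty\le\rho\}<+\infty$. (UGAS): there exists $\sigma\in KL$ such that $\|\phi(t,x_0)\|_\infty\le\sigma(\|x_0\|_\infty,t)$ for all $t\ge0$ and all $x_0\in C^0([-r,0];\mathbb{R}^n)$. *)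

(* Defs.v *)
From mathcomp Require Import all_boot all_order all_algebra.
From mathcomp Require Import all_classical all_reals all_analysis.
Import Order.TTheory GRing.Theory Num.Theory.
Import numFieldNormedType.Exports.

Set Implicit Arguments.
Unset Strict Implicit.
Unset Printing Implicit Defensive.

Local Open Scope classical_set_scope.
Local Open Scope ring_scope.

(* The norm that the library puts on 'rV[R]_n is the maximum norm (it induces
   the same topology); the Euclidean norm is needed separately. *)
Definition enorm {R : realType} {n : nat} (v : 'rV[R]_n) : R :=
  Num.sqrt (\sum_(i < n) v 0 i ^+ 2).

(* An element of C^0([-r,0]; R^n) is represented by a total function R -> R^n
   that is continuous on the subspace [-r,0]; its values outside [-r,0] are
   irrelevant.  Accordingly a functional on C^0([-r,0]; R^n) is a map
   f : (R -> 'rV[R]_n) -> 'rV[R]_n, considered on C0 r only; that f x depends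
   only on the restriction of x to [-r,0] follows from lipschitz_on_bounded,
   because supnorm r (x \- y) = 0 when x and y agree on [-r,0]. *)
Definition C0 {R : realType} {n : nat} (r : R) : set (R -> 'rV[R]_n) :=
  [set x | {within `[- r, 0], continuous x}].

Definition supnorm {R : realType} {n : nat} (r : R) (x : R -> 'rV[R]_n) : R :=
  sup [set enorm (x s) | s in `[- r, 0]].

Definition lipschitz_on_bounded {R : realType} {n : nat} (r : R)
    (f : (R -> 'rV[R]_n) -> 'rV[R]_n) : Prop :=
  exists L : R -> R,
    [/\ forall a, 0 <= a -> 0 <= L a,
        forall a b, 0 <= a -> a <= b -> L a <= L b &
        forall a, 0 <= a -> forall x y, C0 r x -> C0 r y ->
          supnorm r x <= a -> supnorm r y <= a ->
          enorm (f x - f y) <= L a * supnorm r (x \- y)].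

(* x_t *)
Definition segment {R : realType} {n : nat} (x : R -> 'rV[R]_n) (t : R) :
    R -> 'rV[R]_n :=
  fun s => x (t + s).

(* x solves x'(t) = f(x_t) on [0, b) with x_0 = x0; at t = 0 the derivative is
   the right-hand one. *)
Definition solution {R : realType} {n : nat} (r : R)
    (f : (R -> 'rV[R]_n) -> 'rV[R]_n) (x0 : R -> 'rV[R]_n)
    (b : \bar R) (x : R -> 'rV[R]_n) : Prop :=
  [/\ (0 < b)%E,
      {within [set t | - r <= t /\ (t%:E < b)%E], continuous x},
      forall s, - r <= s <= 0 -> x s = x0 s,
      h^-1 *: (x h - x 0) @[h --> 0^'+] --> f (segment x 0) &
      forall t, 0 < t -> (t%:E < b)%E -> is_derive t 1 x (f (segment x t))].

Definition maximal_solution {R : realType} {n : nat} (r : R)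
    (f : (R -> 'rV[R]_n) -> 'rV[R]_n) (x0 : R -> 'rV[R]_n)
    (b : \bar R) (x : R -> 'rV[R]_n) : Prop :=
  solution r f x0 b x /\
  forall (b' : \bar R) (y : R -> 'rV[R]_n), solution r f x0 b' y ->
    (b <= b')%E ->
    (forall t, - r <= t -> (t%:E < b)%E -> y t = x t) ->
    b' = b.

(* The maximal solution together with its existence time, by choice; the
   default value has existence time 0, so that nothing is said to exist at any
   t >= 0 if there is no maximal solution. *)
Definition max_sol {R : realType} {n : nat} (r : R)
    (f : (R -> 'rV[R]_n) -> 'rV[R]_n) (x0 : R -> 'rV[R]_n) :
    \bar R * (R -> 'rV[R]_n) :=
  xget (0%E, fun _ => 0) [set p | maximal_solution r f x0 p.1 p.2].

Definition exists_at {R : realType} {n : nat} (r : R)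
    (f : (R -> 'rV[R]_n) -> 'rV[R]_n) (t : R) (x0 : R -> 'rV[R]_n) : Prop :=
  (t%:E < (max_sol r f x0).1)%E.

(* Meaningful only when exists_at r f t x0. *)
Definition phi {R : realType} {n : nat} (r : R)
    (f : (R -> 'rV[R]_n) -> 'rV[R]_n) (t : R) (x0 : R -> 'rV[R]_n) :
    R -> 'rV[R]_n :=
  segment (max_sol r f x0).2 t.

Definition classK {R : realType} (rho : R -> R) : Prop :=
  [/\ forall s, 0 <= s -> 0 <= rho s,
      {within [set s | 0 <= s], continuous rho},
      forall s1 s2, 0 <= s1 -> s1 < s2 -> rho s1 < rho s2 &
      rho 0 = 0].

Definition classKL {R : realType} (sigma : R -> R -> R) : Prop :=
  [/\ forall t, 0 <= t -> classK (sigma ^~ t),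
      forall s, 0 <= s ->
        forall t1 t2, 0 <= t1 -> t1 <= t2 -> sigma s t2 <= sigma s t1 &
      forall s, 0 <= s -> sigma s t @[t --> +oo] --> 0].

Definition phi_norms {R : realType} {n : nat} (r : R)
    (f : (R -> 'rV[R]_n) -> 'rV[R]_n) (I : set R) (rho : R) : set (\bar R) :=
  [set y | exists t x0, [/\ I t, C0 r x0, supnorm r x0 <= rho &
    y = (supnorm r (phi r f t x0))%:E]].

Definition LS {R : realType} {n : nat} (r : R)
    (f : (R -> 'rV[R]_n) -> 'rV[R]_n) : Prop :=
  forall eps : R, 0 < eps -> exists2 delta : R, 0 < delta &
    (forall t x0, 0 <= t -> C0 r x0 -> supnorm r x0 <= delta ->
       exists_at r f t x0) /\
    (ereal_sup (phi_norms r f [set t | 0 <= t]%R delta) <= eps%:E)%E.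

Definition GA {R : realType} {n : nat} (r : R)
    (f : (R -> 'rV[R]_n) -> 'rV[R]_n) : Prop :=
  forall x0, C0 r x0 ->
    (forall t, 0 <= t -> exists_at r f t x0) /\
    supnorm r (phi r f t x0) @[t --> +oo] --> 0.

Definition GAS {R : realType} {n : nat} (r : R)
    (f : (R -> 'rV[R]_n) -> 'rV[R]_n) : Prop :=
  LS r f /\ GA r f.

Definition RFC {R : realType} {n : nat} (r : R)
    (f : (R -> 'rV[R]_n) -> 'rV[R]_n) : Prop :=
  forall rho T : R, 0 < rho -> 0 < T ->
    (forall t x0, 0 <= t <= T -> C0 r x0 -> supnorm r x0 <= rho ->
       exists_at r f t x0) /\
    (ereal_sup (phi_norms r f [set t | 0 <= t <= T]%R rho) < +oo)%E.

Definition UGAS {R : realType} {n : nat} (r : R)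
    (f : (R -> 'rV[R]_n) -> 'rV[R]_n) : Prop :=
  exists2 sigma : R -> R -> R, classKL sigma &
    forall t x0, 0 <= t -> C0 r x0 ->
      exists_at r f t x0 /\
      supnorm r (phi r f t x0) <= sigma (supnorm r x0) t.

(* Main.v *)
Require Import Defs.
From mathcomp Require Import all_boot all_order all_algebra.
From mathcomp Require Import all_classical all_reals all_analysis.
From mathcomp Require Import ring lra.
Import Order.TTheory GRing.Theory Num.Theory.
Import numFieldNormedType.Exports.

Set Implicit Arguments.
Unset Strict Implicit.
Unset Printing Implicit Defensive.

Local Open Scope classical_set_scope.
Local Open Scope ring_scope.

(** The heart of the matter is uniform attraction: (RFC) makes every solution
global and bounded on bounded times, uniformly over bounded sets of initial
functions, and (LS) controls what happens near the origin; the decay time in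
(GA), however, depends on the initial function, and has to be made uniform
over bounded sets.

In the infinite-dimensional space C^0([-r,0]; R^n) bounded sets are not
precompact, but the flow regularizes them.  If the norm of x0 is at most rho,
then (RFC) bounds the solution on [0,r], hence also its derivative, so that
phi(r,x0) lies in a set of functions that are bounded by a fixed M and
Lipschitz with a fixed constant ([phi_regularity]).  By Tychonoff's theorem
this set is compact for pointwise convergence ([compact_lip_ball]), and on it
pointwise convergence implies uniform convergence on [-r,0]
([near_lip_ball_supnorm]); together these are the Arzela-Ascoli theorem.  For
each g in it, (GA) brings phi(t,g) into the stability ball of (LS) at some
time; by continuous dependence ([phi_lipschitz]) the same time works for all
functions of the set near g, and by (LS) and the semigroup property they stay small
afterwards.  Compactness then gives one time for the whole set
([uniform_attraction]).

Continuous dependence and the semigroup property (hence uniqueness) both come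
from one Gronwall estimate, [gronwall], which is obtained from the mean value
inequality by looking at the point where the weighted distance
|x(t) - y(t)| exp(-Lt) of the two solutions is maximal.

Finally, stability near 0, boundedness and uniform attraction produce a
class-KL bound by taking suprema against continuous cut-off functions of the
size of the initial function ([KL_majorant]).  The converse implication reads
all the properties off the bound sigma. *)

(** * The Euclidean norm *)

Definition dotv {R : realType} {n} (u v : 'rV[R]_n) : R := \sum_(i < n) u 0 i * v 0 i.

Lemma enorm_ge0 (R : realType) n (v : 'rV[R]_n) : 0 <= enorm v.
Proof. exact: sqrtr_ge0. Qed.

Lemma sqr_enorm (R : realType) n (v : 'rV[R]_n) : enorm v ^+ 2 = dotv v v.
Proof.
rewrite /enorm sqr_sqrtr; last by apply: sumr_ge0 => i _; exact: sqr_ge0.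
by apply: eq_bigr => i _; rewrite expr2.
Qed.

Lemma enorm0 (R : realType) n : enorm (0 : 'rV[R]_n) = 0.
Proof. by rewrite /enorm big1 ?sqrtr0// => i _; rewrite mxE expr0n. Qed.

Lemma coord_le_enorm (R : realType) n (v : 'rV[R]_n) i : `|v 0 i| <= enorm v.
Proof.
rewrite -sqrtr_sqr ler_sqrt; last by apply: sumr_ge0 => j _; exact: sqr_ge0.
by rewrite (bigD1 i)//= lerDl sumr_ge0// => j _; exact: sqr_ge0.
Qed.

Lemma enorm_eq0 (R : realType) n (v : 'rV[R]_n) : enorm v <= 0 -> v = 0.
Proof.
move=> v0; apply/rowP => i; rewrite mxE; apply/eqP; rewrite -normr_le0.
exact: le_trans (coord_le_enorm v i) v0.
Qed.

(** Cauchy-Schwarz: expand the sum of the squares of u_i |v| - v_i |u|. *)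
Lemma dotv_le (R : realType) n (u v : 'rV[R]_n) : dotv u v <= enorm u * enorm v.
Proof.
have [u0|u0] := ltP 0 (enorm u); last first.
  by rewrite (enorm_eq0 u0) enorm0 mul0r /dotv big1// => i _; rewrite mxE mul0r.
have [v0|v0] := ltP 0 (enorm v); last first.
  by rewrite (enorm_eq0 v0) enorm0 mulr0 /dotv big1// => i _; rewrite mxE mulr0.
have : 0 <= \sum_(i < n) (u 0 i * enorm v - v 0 i * enorm u) ^+ 2.
  by apply: sumr_ge0 => i _; exact: sqr_ge0.
rewrite (_ : \sum_(i < n) _ = 2 * (enorm u * enorm v) * (enorm u * enorm v - dotv u v)).
  by rewrite pmulr_rge0 ?subr_ge0// mulr_gt0// mulr_gt0.
transitivity (dotv u u * enorm v ^+ 2 - 2 * (enorm u * enorm v) * dotv u v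
              + dotv v v * enorm u ^+ 2); last by rewrite -!sqr_enorm; ring.
rewrite /dotv !mulr_suml mulr_sumr -sumrB -big_split/=.
by apply: eq_bigr => i _; ring.
Qed.

Lemma ler_enormD (R : realType) n (u v : 'rV[R]_n) :
  enorm (u + v) <= enorm u + enorm v.
Proof.
rewrite -(ler_pXn2r (n := 2))// ?nnegrE ?addr_ge0 ?enorm_ge0//.
rewrite sqr_enorm sqrrD !sqr_enorm.
have := dotv_le u v; set a := _ * _.
rewrite (_ : dotv (u + v) (u + v) = dotv u u + dotv u v *+ 2 + dotv v v); first lra.
rewrite /dotv -sumrMnl -!big_split/=; apply: eq_bigr => i _; rewrite !mxE; ring.
Qed.

Lemma enormN (R : realType) n (v : 'rV[R]_n) : enorm (- v) = enorm v.
Proof. by congr Num.sqrt; apply: eq_bigr => i _; rewrite mxE sqrrN. Qed.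

Lemma enormB (R : realType) n (u v : 'rV[R]_n) : enorm (u - v) = enorm (v - u).
Proof. by rewrite -enormN opprB. Qed.

Lemma sum_coord_continuous (R : realType) n (F : 'I_n -> 'rV[R]_n -> R) :
  (forall i, continuous (F i)) -> continuous (fun v => \sum_(i < n) F i v).
Proof.
move=> cF v; have nF : Filter (nbhs v) by exact: nbhs_filter.
apply: (@cvg_big _ _ +%R 0 _ _ _ (nbhs v)) => [|i _]; first exact: add_continuous.
exact: cF.
Qed.

Lemma enorm_continuous (R : realType) n : continuous (@enorm R n).
Proof.
move=> v; apply: continuous_comp; last exact: sqrt_continuous.
apply: sum_coord_continuous => i w.
apply: (@continuous_comp _ _ _ (fun w : 'rV[R]_n => w 0 i) (fun a : R => a ^+ 2)).
  exact: coord_continuous.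
exact: exprn_continuous.
Qed.

(** Compares the Euclidean norm with the maximum norm, which defines the topology
of row vectors. *)
Lemma mx_norm_le_enorm (R : realType) n (v : 'rV[R]_n) : `|v| <= enorm v.
Proof.
rewrite (_ : `|v| = mx_norm v)//.
have [->|v0] := eqVneq (mx_norm v) 0; first exact: enorm_ge0.
have [[i j] /= ->] := mx_norm_neq0 v0.
by rewrite (ord1 i) coord_le_enorm.
Qed.

(** * Differentiation of vector-valued functions *)

Lemma within_continuous_precomp (U V W : topologicalType) (A : set U) (B : set V)
    (g : U -> V) (f : V -> W) :
  continuous g -> (forall u, A u -> B (g u)) ->
  {within B, continuous f} -> {within A, continuous (f \o g)}.
Proof.
move=> cg AB /subspace_continuousP cf; apply/subspace_continuousP => u Au.
move=> P fP; have {}fP : nbhs (g u) [set v | B v -> P (f v)] := cf _ (AB _ Au) _ fP.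
rewrite /nbhs/=/within/=.
apply: (@filterS _ _ (nbhs_filter u)) (cg u _ fP) => v /= Pv /AB; exact: Pv.
Qed.

Lemma is_derive_translate (R : realType) (V : normedModType R) (x : R -> V) (s t : R) d :
  is_derive (s + t) 1 x d -> is_derive t 1 (fun u => x (s + u)) d.
Proof.
case=> dx xd; have E : (fun h => h^-1 *: ((x \o shift (s + t)) (h *: 1) - x (s + t))) =
  (fun h => h^-1 *: (((fun u => x (s + u)) \o shift t) (h *: 1) - x (s + t))).
  by apply/funext => h /=; rewrite addrCA.
split; first by move: dx; rewrite /derivable /= E.
by rewrite -xd /derive /= E.
Qed.

Lemma is_derive_dotv (R : realType) n (z : R -> 'rV[R]_n) (t : R) dz u :
  is_derive t 1 z dz -> is_derive t 1 (fun s => dotv (z s) u) (dotv dz u).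
Proof.
move=> [zd zdz].
have dzi i : is_derive t 1 (fun s => z s 0 i) (dz 0 i).
  split; first exact: (derivable_mxP _ _ _).1 zd 0 i.
  by rewrite -zdz derive_mx// mxE.
have -> : (fun s => dotv (z s) u) = \sum_(i < n) (u 0 i \*: (fun s => z s 0 i)).
  apply/funext => s; rewrite fct_sumE; apply: eq_bigr => i _.
  by rewrite /= mulrC.
rewrite (_ : dotv _ _ = \sum_(i < n) (u 0 i *: dz 0 i)); last first.
  by apply: eq_bigr => i _; rewrite mulrC.
exact: is_derive_sum.
Qed.

(** The scalar mean value theorem applied to t |-> <z t, u> - |u| g t, where
u = z b - z a: by Cauchy-Schwarz this function has a nonpositive derivative. *)
Lemma mean_value_enorm (R : realType) n (z dz : R -> 'rV[R]_n) (g dg : R -> R) a b :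
  a <= b ->
  {within `[a, b], continuous z} -> {within `[a, b], continuous g} ->
  (forall t : R, a < t < b -> is_derive t 1 z (dz t)) ->
  (forall t : R, a < t < b -> is_derive t 1 g (dg t)) ->
  (forall t : R, a < t < b -> enorm (dz t) <= dg t) ->
  enorm (z b - z a) <= g b - g a.
Proof.
rewrite le_eqVlt => /predU1P[->|ab]; first by rewrite !subrr enorm0.
move=> cz cg zdz gdg dzg.
set u := z b - z a.
pose h t := dotv (z t) u - enorm u * g t.
pose dh t := dotv (dz t) u - enorm u * dg t.
(* If u = 0, it remains to see that g b >= g a, as dg >= 0. *)
have [u0|u0] := leP (enorm u) 0.
  have [c cab ->] := MVT ab (fun t tab => gdg t tab) cg.
  apply: le_trans u0 _; apply: mulr_ge0; last by rewrite subr_ge0 ltW.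
  exact: le_trans (enorm_ge0 _) (dzg _ _).
have ch : {within `[a, b], continuous h}.
  apply: within_continuousB; last first.
    apply: (@within_continuous_comp _ _ _ _ g (fun v => enorm u * v)) => // v _.
    exact: mulrl_continuous.
  apply: (@within_continuous_comp _ _ _ _ z (fun v => dotv v u)) => // v _.
  by apply: sum_coord_continuous => i w; apply: (@continuousM _ _ (fun w : 'rV[R]_n => w 0 i) (fun=> u 0 i));
    [exact: coord_continuous|exact: cst_continuous].
have hd t : t \in `]a, b[ -> is_derive t 1 h (dh t).
  move=> tab; apply: is_deriveB; first by apply: is_derive_dotv; exact: zdz.
  by apply: (is_deriveZ (enorm u)); exact: gdg.
have [c cab] := MVT ab hd ch.
have : dh c * (b - a) <= 0.
  apply: mulr_le0_ge0; last by rewrite subr_ge0 ltW.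
  rewrite /dh subr_le0.
  apply: le_trans (dotv_le _ _) _.
  by rewrite mulrC ler_pM2l// dzg.
move=> /[swap] <-; rewrite /h.
have -> : dotv (z b) u - enorm u * g b - (dotv (z a) u - enorm u * g a) =
    enorm u ^+ 2 - enorm u * (g b - g a).
  rewrite sqr_enorm {5}/u.
  have -> : dotv (z b - z a) u = dotv (z b) u - dotv (z a) u.
    by rewrite /dotv -sumrB; apply: eq_bigr => i _; rewrite !mxE mulrBl.
  ring.
by rewrite subr_le0 expr2 ler_pM2l.
Qed.

(** * The uniform norm and the Gronwall estimate *)

Lemma enorm_le_supnorm (R : realType) n (r : R) (x : R -> 'rV[R]_n) s :
  C0 r x -> - r <= s <= 0 -> enorm (x s) <= supnorm r x.
Proof.
move=> cx /andP[rs s0]; apply: ub_le_sup; last by exists s => //=; rewrite in_itv/= rs.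
have cex : {within `[- r, 0], continuous (@enorm R n \o x)}.
  by apply: within_continuous_comp => // v _; exact: enorm_continuous.
have [c _ cmax] := EVT_max (le_trans rs s0) cex.
by exists (enorm (x c)) => _ [t rt <-]; exact: cmax.
Qed.

Lemma supnorm_le (R : realType) n (r : R) (x : R -> 'rV[R]_n) a : 0 <= r ->
  (forall s, - r <= s <= 0 -> enorm (x s) <= a) -> supnorm r x <= a.
Proof.
move=> r0 xa; apply: ge_sup.
  by exists (enorm (x 0)), 0 => //=; rewrite in_itv/= lexx oppr_le0 r0.
by move=> _ [s + <-]; rewrite /= in_itv/=; exact: xa.
Qed.

Lemma supnorm_ge0 (R : realType) n (r : R) (x : R -> 'rV[R]_n) :
  0 <= r -> C0 r x -> 0 <= supnorm r x.
Proof.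
move=> r0 cx; apply: le_trans (enorm_ge0 (x 0)) _.
by apply: enorm_le_supnorm => //; rewrite lexx oppr_le0 r0.
Qed.

Lemma eq_supnorm (R : realType) n (r : R) (x y : R -> 'rV[R]_n) :
  (forall s, - r <= s <= 0 -> x s = y s) -> supnorm r x = supnorm r y.
Proof.
move=> xy; congr sup; apply/seteqP; split=> _ [s /= rs <-]; exists s => //=;
  by rewrite xy// -in_itv.
Qed.

Lemma C0B (R : realType) n (r : R) (x y : R -> 'rV[R]_n) :
  C0 r x -> C0 r y -> C0 r (x \- y).
Proof. exact: within_continuousB. Qed.

Lemma C0_segment (R : realType) n (r T t : R) (x : R -> 'rV[R]_n) :
  {within `[- r, T], continuous x} -> 0 <= t <= T -> C0 r (segment x t).
Proof.
move=> cx /andP[t0 tT].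
apply: (within_continuous_precomp (B := `[- r, T]) (g := fun s => t + s)) cx.
- by move=> s; apply: cvgD; [exact: cvg_cst|exact: cvg_id].
- by move=> s /=; rewrite !in_itv/= => /andP[rs s0]; apply/andP; split; lra.
Qed.

(** Since f vanishes at 0, its Lipschitz constant on a ball also bounds it there. *)
Lemma functional_bound (R : realType) n (r : R) f :
  0 <= r -> f (fun _ => 0) = 0 :> 'rV[R]_n -> lipschitz_on_bounded r f ->
  forall M, 0 <= M -> exists2 L, 0 <= L &
    (forall x y, C0 r x -> C0 r y -> supnorm r x <= M -> supnorm r y <= M ->
       enorm (f x - f y) <= L * supnorm r (x \- y)) /\
    (forall x, C0 r x -> supnorm r x <= M -> enorm (f x) <= L * M).
Proof.
move=> r0 f0 [L [L0 _ fL]] M M0; exists (L M); first exact: L0.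
split=> [x y|x cx xM]; first exact: fL.
have := fL M M0 x (fun=> 0) cx (continuous_subspaceT (@cst_continuous _ _ _)) xM.
rewrite f0 subr0 (_ : x \- _ = x); last by apply/funext => s /=; rewrite subr0.
move=> /(_ _)/le_trans; apply; first by apply: supnorm_le => // s _; rewrite enorm0.
by rewrite ler_wpM2l// L0.
Qed.

(** Unlike a solution, a trajectory has no prescribed derivative at 0; this makes
the notion stable under translation in time, and by [gronwall] a bounded x is
still determined by its values on [-r,0] when f is Lipschitz on bounded sets. *)
Definition trajectory {R : realType} {n} (r : R) (f : (R -> 'rV[R]_n) -> 'rV[R]_n)
    (T : R) (x : R -> 'rV[R]_n) : Prop :=
  {within `[- r, T], continuous x} /\
  forall t : R, 0 < t < T -> is_derive t 1 x (f (segment x t)).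

(** Let m be the maximum over [0,T] of |x t - y t| exp(-L t), attained at c.  If
m > D, then m exp(L t) bounds the distance of the segments at every time t in
[0,c], so L m exp(L t) bounds the speed of x - y.  Integrating from 0 to c
gives m exp(L c) <= D + m exp(L c) - m, that is, m <= D. *)
Lemma gronwall (R : realType) n (r : R) f (L M T D : R) (x y : R -> 'rV[R]_n) :
  0 <= r -> 0 <= L ->
  (forall u v, C0 r u -> C0 r v -> supnorm r u <= M -> supnorm r v <= M ->
       enorm (f u - f v) <= L * supnorm r (u \- v)) ->
  trajectory r f T x -> trajectory r f T y ->
  (forall t, 0 <= t <= T -> supnorm r (segment x t) <= M) ->
  (forall t, 0 <= t <= T -> supnorm r (segment y t) <= M) ->
  (forall s, - r <= s <= 0 -> enorm (x s - y s) <= D) ->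
  forall t, 0 <= t <= T -> enorm (x t - y t) <= D * expR (L * t).
Proof.
move=> r0 L0 fL [cx dx] [cy dy] xM yM xyD t0 t0T.
have T0 : 0 <= T by lra.
pose z := x \- y.
have cz : {within `[- r, T], continuous z} by exact: within_continuousB.
have cz0 a b : 0 <= a -> b <= T -> {within `[a, b], continuous z}.
  move=> a0 bT; apply: continuous_subspaceW cz => s /=; rewrite !in_itv/=; lra.
have cexp k : continuous (fun t : R => expR (k * t)).
  move=> s; apply: continuous_comp; first exact: mulrl_continuous.
  exact: continuous_expR.
pose q t := enorm (z t) * expR (- L * t).
have zq t : enorm (z t) = q t * expR (L * t).
  by rewrite /q -mulrA -expRD mulNr addNr expR0 mulr1.
have cq : {within `[0, T], continuous q}.
  have ce : {within `[0, T], continuous (@enorm R n \o z)}.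
    apply: within_continuous_comp; last exact: cz0.
    by move=> v _; exact: enorm_continuous.
  have cE : {within `[0, T], continuous (fun t : R => expR (- L * t))}.
    by apply: continuous_subspaceT; exact: cexp.
  by move=> s; exact: (continuousM (ce s) (cE s)).
have [c + cmax] := EVT_max T0 cq.
rewrite in_itv/= => /andP[c0 cT].
suff qD : q c <= D.
  rewrite -/(z t0) zq ler_wpM2r ?expR_ge0//; apply: le_trans qD.
  by apply: cmax; rewrite in_itv.
rewrite leNgt; apply/negP => Dq.
have D0 : 0 <= D.
  by apply: le_trans (enorm_ge0 _) (xyD 0 _); rewrite lexx oppr_le0 r0.
have m0 : 0 <= q c by lra.
have zbound t : 0 <= t <= T -> supnorm r (segment x t \- segment y t) <= q c * expR (L * t).
  move=> /andP[t_ge0 tT]; apply: supnorm_le => // s /andP[rs s0].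
  rewrite /segment/= -/(z (t + s)).
  (* At t + s <= 0 the initial bound D < m applies, afterwards maximality of m. *)
  have [ts|ts] := leP (t + s) 0.
    apply: (@le_trans _ _ D); first by apply: xyD; lra.
    rewrite -[D]mulr1 ler_pM ?(ltW Dq)//.
    by rewrite -expR0 ler_expR mulr_ge0.
  rewrite zq ler_pM ?expR_ge0//; first by rewrite mulr_ge0 ?enorm_ge0 ?expR_ge0.
    by apply: cmax; rewrite in_itv/=; lra.
  by rewrite ler_expR ler_wpM2l//; lra.
have : enorm (z c - z 0) <= q c * expR (L * c) - q c * expR (L * 0).
  apply: (@mean_value_enorm R n z (fun t => f (segment x t) - f (segment y t))
    (fun t => q c * expR (L * t)) (fun t => L * (q c * expR (L * t))) 0 c c0
    (cz0 _ _ (lexx 0) cT)) => [|t tc|t tc|t tc].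
  - apply: continuous_subspaceT => s.
    apply: (@continuous_comp _ _ _ (fun t : R => expR (L * t)) (fun v => q c * v)).
      exact: cexp.
    exact: mulrl_continuous.
  - by apply: is_deriveB; [apply: dx|apply: dy]; lra.
  - have dL : is_derive t 1 (fun t : R => L * t) (L * 1).
      by apply: (is_deriveZ L); exact: is_derive_id.
    have dE := is_deriveZ (q c) (is_derive1_comp (is_derive_expR (L * t)) dL).
    by apply: is_derive_eq dE _; rewrite /GRing.scale/=; ring.
  - apply: le_trans (fL _ _ _ _ _ _) _.
    + by apply: C0_segment cx _; lra.
    + by apply: C0_segment cy _; lra.
    + by apply: xM; lra.
    + by apply: yM; lra.
    by rewrite ler_wpM2l// zbound//; lra.
(* The right-hand side is now |z c| - m, and |z 0| <= D < m. *)
rewrite mulr0 expR0 mulr1 -zq leNgt => /negP; apply.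
have := ler_enormD (z c - z 0) (z 0); rewrite subrK.
have : enorm (z 0) <= D by apply: xyD; rewrite lexx oppr_le0 r0.
lra.
Qed.

(** * The flow under robust forward completeness *)

(** The form in which (RFC) is used: a real bound, for all real rho and T.  It
contains global existence: for given t and x0 take T = t and rho the norm of
x0. *)
Definition bounded_reach {R : realType} {n} (r : R)
    (f : (R -> 'rV[R]_n) -> 'rV[R]_n) : Prop :=
  forall rho T : R, exists2 M : R, 0 <= M &
    forall t x0, 0 <= t <= T -> C0 r x0 -> supnorm r x0 <= rho ->
      exists_at r f t x0 /\ supnorm r (phi r f t x0) <= M.

Lemma phi_norms_le (R : realType) n (r : R) (f : (R -> 'rV[R]_n) -> 'rV[R]_n)
    (I : set R) rho M : (ereal_sup (phi_norms r f I rho) <= M%:E)%E ->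
  forall t x0, I t -> C0 r x0 -> supnorm r x0 <= rho -> supnorm r (phi r f t x0) <= M.
Proof.
move=> supM t x0 It cx0 x0rho; rewrite -lee_fin; apply: le_trans supM.
by apply: ereal_sup_ubound; exists t, x0.
Qed.

Lemma RFC_bounded_reach (R : realType) n (r : R) (f : (R -> 'rV[R]_n) -> 'rV[R]_n) :
  RFC r f -> bounded_reach r f.
Proof.
move=> rfc rho T.
have r1 : 0 < `|rho| + 1 by rewrite ltr_wpDl.
have T1 : 0 < `|T| + 1 by rewrite ltr_wpDl.
have [ex sup_lty] := rfc _ _ r1 T1.
have [M supM] : exists M : R, (ereal_sup (phi_norms r f
    [set t | 0 <= t <= `|T| + 1]%R (`|rho| + 1)) <= M%:E)%E.
  case: (ereal_sup _) sup_lty => [m _|//|_]; first by exists m.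
  by exists 0; exact: leNye.
exists `|M| => // t x0 /andP[t0 tT] cx0 x0rho.
have x0rho1 : supnorm r x0 <= `|rho| + 1.
  by apply: le_trans x0rho _; apply: le_trans (ler_norm _) _; rewrite lerDl.
have tT1 : 0 <= t <= `|T| + 1.
  by rewrite t0; apply: le_trans tT _; apply: le_trans (ler_norm _) _; rewrite lerDl.
split; first exact: ex.
by apply: le_trans (ler_norm _); apply: phi_norms_le supM _ _ _ _ _.
Qed.

(** The default maximal solution has existence time 0, so existence at time 0
already shows that the chosen pair is a genuine maximal solution. *)
Lemma max_sol_trajectory (R : realType) n (r : R) (f : (R -> 'rV[R]_n) -> 'rV[R]_n) x0 :
  (forall t, 0 <= t -> exists_at r f t x0) ->
  (forall T, trajectory r f T (max_sol r f x0).2) /\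
  (forall s, - r <= s <= 0 -> (max_sol r f x0).2 s = x0 s).
Proof.
move=> ex; have := ex 0 (lexx 0); move: ex; rewrite /exists_at /max_sol.
case: xgetP => [p pE|_ /=]; last by rewrite ltxx.
move=> [[b0 cx x0E _ dx] _] ex _.
have bT (T t : R) : t <= T -> (t%:E < p.1)%E.
  by move=> tT; apply: le_lt_trans (ex `|T| _) => //; rewrite lee_fin (le_trans tT)// ler_norm.
split=> // T; split.
  apply: continuous_subspaceW cx => s /=; rewrite in_itv/= => /andP[rs sT].
  by split => //; exact: bT sT.
by move=> t /andP[t0 tT]; apply: dx => //; exact: bT (ltW tT).
Qed.

Lemma bounded_reach_global (R : realType) n (r : R) (f : (R -> 'rV[R]_n) -> 'rV[R]_n) x0 :
  bounded_reach r f -> C0 r x0 -> forall t, 0 <= t -> exists_at r f t x0.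
Proof.
move=> /(_ (supnorm r x0)) br cx0 t t0; have [M _ ext] := br t.
by apply: (ext t x0 _ _ _).1 => //; rewrite t0/=.
Qed.

Lemma C0_phi (R : realType) n (r : R) (f : (R -> 'rV[R]_n) -> 'rV[R]_n) x0 t :
  bounded_reach r f -> C0 r x0 -> 0 <= t -> C0 r (phi r f t x0).
Proof.
move=> br cx0 t0.
have [traj _] := max_sol_trajectory (bounded_reach_global br cx0).
by apply: C0_segment (traj t).1 _; rewrite t0 lexx.
Qed.

(** The solutions starting in the ball of radius rho stay in one ball up to time
T, where f has one Lipschitz constant. *)
Lemma phi_lipschitz (R : realType) n (r : R) (f : (R -> 'rV[R]_n) -> 'rV[R]_n) :
  0 <= r -> f (fun _ => 0) = 0 -> lipschitz_on_bounded r f -> bounded_reach r f ->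
  forall rho T, exists2 C, 0 <= C &
    forall x y t, C0 r x -> C0 r y -> supnorm r x <= rho -> supnorm r y <= rho ->
      0 <= t <= T -> supnorm r (phi r f t x \- phi r f t y) <= C * supnorm r (x \- y).
Proof.
move=> r0 f0 flip br rho T.
have [M M0 reachM] := br rho T.
have [L L0 [fL _]] := functional_bound r0 f0 flip M0.
exists (expR (L * T)); first exact: expR_ge0.
move=> x y t cx cy xrho yrho /andP[t0 tT].
have [trajx x0] := max_sol_trajectory (bounded_reach_global br cx).
have [trajy y0] := max_sol_trajectory (bounded_reach_global br cy).
have D0 : 0 <= supnorm r (x \- y) by apply: supnorm_ge0 => //; exact: C0B.
apply: supnorm_le => // s /andP[rs s0]; rewrite /phi /segment/=.
have init u : - r <= u <= 0 ->
    enorm ((max_sol r f x).2 u - (max_sol r f y).2 u) <= supnorm r (x \- y).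
  move=> ru; rewrite x0// y0//.
  by apply: (@enorm_le_supnorm _ _ _ (x \- y)) => //; exact: C0B.
have [ts|ts] := leP (t + s) 0.
  apply: (@le_trans _ _ (supnorm r (x \- y))); first by apply: init; lra.
  rewrite -[leLHS]mul1r ler_wpM2r// -expR0 ler_expR mulr_ge0//.
  exact: le_trans tT.
apply: le_trans (gronwall r0 L0 fL (trajx T) (trajy T) _ _ init _) _.
- by move=> u uT; apply: (reachM u x _ _ _).2.
- by move=> u uT; apply: (reachM u y _ _ _).2.
- by lra.
by rewrite mulrC ler_wpM2r// ler_expR ler_wpM2l//; lra.
Qed.

(** Only the values of phi(s,x0) on [-r,0] matter, so the flow may be restarted
from any y0 that agrees with it there; this allows phi(s,x0) to be replaced
by a globally Lipschitz extension.  The proof is the Gronwall estimate with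
initial distance 0. *)
Lemma phi_semigroup (R : realType) n (r : R) (f : (R -> 'rV[R]_n) -> 'rV[R]_n) x0 y0 s t :
  0 <= r -> f (fun _ => 0) = 0 -> lipschitz_on_bounded r f -> bounded_reach r f ->
  C0 r x0 -> C0 r y0 -> 0 <= s -> 0 <= t ->
  (forall u, - r <= u <= 0 -> y0 u = phi r f s x0 u) ->
  supnorm r (phi r f (s + t) x0) = supnorm r (phi r f t y0).
Proof.
move=> r0 f0 flip br cx cy s0 t0 y0E.
have [Mx Mx0 reachx] := br (supnorm r x0) (s + t).
have [My My0 reachy] := br (supnorm r y0) t.
have M0 : 0 <= Mx + My by exact: addr_ge0.
have [L L0 [fL _]] := functional_bound r0 f0 flip M0.
have [trajx _] := max_sol_trajectory (bounded_reach_global br cx).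
have [trajy y0y] := max_sol_trajectory (bounded_reach_global br cy).
pose x := (max_sol r f x0).2; pose y := (max_sol r f y0).2.
have segD u : segment (segment x s) u = segment x (s + u).
  by apply/funext => v; rewrite /segment addrA.
have traj_s : trajectory r f t (segment x s).
  split.
    apply: (within_continuous_precomp (B := `[- r, s + t]) (g := fun u => s + u)).
    - by move=> u; apply: cvgD; [exact: cvg_cst|exact: cvg_id].
    - by move=> u /=; rewrite !in_itv/=; lra.
    - exact: (trajx (s + t)).1.
  move=> u ut; rewrite segD; apply: is_derive_translate.
  by apply: (trajx (s + t)).2; lra.
have init u : - r <= u <= 0 -> enorm (segment x s u - y u) <= 0.
  by move=> ru; rewrite /y y0y// y0E// /phi subrr enorm0.
apply: eq_supnorm => v /andP[rv v0].
rewrite /phi -/x -/y -segD; apply/eqP; rewrite -subr_eq0; apply/eqP/enorm_eq0.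
rewrite {1 3}/segment.
have [tv|tv] := leP (t + v) 0; first by apply: init; lra.
apply: le_trans (gronwall r0 L0 fL traj_s (trajy t) _ _ init _) _.
- move=> u ut; rewrite segD; apply: (@le_trans _ _ Mx); last by rewrite lerDl.
  by apply: (reachx (s + u) x0 _ _ _).2 => //; lra.
- move=> u ut; apply: (@le_trans _ _ My); last by rewrite lerDr.
  by apply: (reachy u y0 _ _ _).2.
- by lra.
- by rewrite mul0r.
Qed.

(** At time r the initial function has been forgotten: phi(r,x0) is a piece of
the solution on [0,r], where the derivative is f(x_t) and f is bounded. *)
Lemma phi_regularity (R : realType) n (r : R) (f : (R -> 'rV[R]_n) -> 'rV[R]_n) :
  0 <= r -> f (fun _ => 0) = 0 -> lipschitz_on_bounded r f -> bounded_reach r f ->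
  forall rho, exists M Lam, [/\ 0 <= M, 0 <= Lam &
    forall x0, C0 r x0 -> supnorm r x0 <= rho ->
      (forall s, - r <= s <= 0 -> enorm (phi r f r x0 s) <= M) /\
      (forall s s', - r <= s <= 0 -> - r <= s' <= 0 ->
        enorm (phi r f r x0 s - phi r f r x0 s') <= Lam * `|s - s'|)].
Proof.
move=> r0 f0 flip br rho.
have [M M0 reachM] := br rho r.
have [L L0 [_ fM]] := functional_bound r0 f0 flip M0.
exists M, (L * M); split=> //; first exact: mulr_ge0.
move=> x0 cx x0rho.
have [traj _] := max_sol_trajectory (bounded_reach_global br cx).
split.
  move=> s rs; apply: le_trans (enorm_le_supnorm _ rs) _; first exact: C0_phi.
  by apply: (reachM r x0 _ _ _).2 => //; rewrite r0 lexx.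
move=> s s'; wlog ss' : s s' / s <= s'.
  move=> W rs rs'; have [/W|/ltW/W] := leP s s'; first exact.
  by rewrite enormB distrC; exact.
move=> rs rs'; rewrite enormB distrC ger0_norm ?subr_ge0//.
have [cx' dx'] := traj r.
have -> : L * M * (s' - s) = L * M * (r + s') - L * M * (r + s) by ring.
rewrite /phi /segment.
set x := (max_sol r f x0).2 in dx' cx' *.
apply: (@mean_value_enorm _ _ x (fun t => f (segment x t)) (fun t => L * M * t)
  (fun=> L * M)).
- by rewrite lerD2l.
- by apply: continuous_subspaceW cx' => u /=; rewrite !in_itv/=; lra.
- by apply: continuous_subspaceT; exact: mulrl_continuous.
- by move=> t rt; apply: dx'; lra.
- move=> t rt; have dL : is_derive t 1 (fun t : R => L * M * t) (L * M * 1).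
    by apply: (is_deriveZ (L * M)); exact: is_derive_id.
  by apply: is_derive_eq dL _; rewrite mulr1.
- move=> t rt; apply: fM; first by apply: C0_segment cx' _; lra.
  by apply: (reachM t x0 _ _ _).2 => //; lra.
Qed.

(** * Compactness of bounded sets of Lipschitz functions *)

(** The conditions are imposed at all real arguments, and not only on [-r,0], so
that the set is compact in a product indexed by all reals. *)
Definition lip_ball {R : realType} {n} (M Lam : R) : set {ptws R -> 'rV[R]_n} :=
  [set g | (forall s, enorm (g s) <= M) /\
     forall s s', enorm (g s - g s') <= Lam * `|s - s'|].

Lemma compact_enorm_ball (R : realType) n (M : R) :
  compact [set v : 'rV[R]_n | enorm v <= M].
Proof.
apply: (@subclosed_compact _ _ [set v : 'rV[R]_n | forall i, `[- M, M]%classic (v ord0 i)]).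
- apply: closed_comp (@closed_le _ M) => v _; exact: enorm_continuous.
- by apply: (@rV_compact _ _ (fun=> `[- M, M]%classic)) => i; exact: segment_compact.
- move=> v vM i; rewrite /= in_itv/= -ler_norml; exact: le_trans (coord_le_enorm v i) vM.
Qed.

Lemma eval_continuous (R : realType) n (s : R) :
  continuous (fun g : {ptws R -> 'rV[R]_n} => g s).
Proof. exact: (@proj_continuous R (fun=> 'rV[R]_n) s). Qed.

(** A product of compact balls, cut by the closed conditions that compare two
values. *)
Lemma compact_lip_ball (R : realType) n (M Lam : R) : compact (@lip_ball R n M Lam).
Proof.
pose box : set {ptws R -> 'rV[R]_n} := [set g | forall s, enorm (g s) <= M].
have cbox : compact box.
  by apply: (@tychonoff R (fun=> 'rV[R]_n) (fun=> [set v | enorm v <= M])) => s;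
    exact: compact_enorm_ball.
pose lip : set {ptws R -> 'rV[R]_n} :=
  \bigcap_(p in [set: R * R]) [set g | enorm (g p.1 - g p.2) <= Lam * `|p.1 - p.2|].
rewrite (_ : lip_ball _ _ = box `&` lip); last first.
  apply/seteqP; split=> g [gM gL]; split=> //.
    by move=> [s s'] _; exact: gL.
  by move=> s s'; exact: (gL (s, s')).
apply: compact_closedI => //; apply: closed_bigI => -[s s'] _ /=.
have c : continuous (fun g : {ptws R -> 'rV[R]_n} => enorm (g s - g s')).
  move=> g; apply: continuous_comp; last exact: enorm_continuous.
  by apply: continuousB; exact: eval_continuous.
by apply: closed_comp (@closed_le _ (Lam * `|s - s'|)) => g _; exact: c.
Qed.

Lemma lip_ball_C0 (R : realType) n (r M Lam : R) (g : R -> 'rV[R]_n) :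
  0 <= Lam -> lip_ball M Lam g -> C0 r g.
Proof.
move=> Lam0 [_ gL]; apply: continuous_subspaceT => s; apply/cvgrPdist_le => e e0.
have L1 : 0 < Lam + 1 by lra.
near=> t; apply: le_trans (mx_norm_le_enorm _) _; apply: le_trans (gL _ _) _.
apply: (@le_trans _ _ ((Lam + 1) * `|s - t|)); first by rewrite ler_wpM2r// lerDl.
rewrite mulrC -ler_pdivlMr//.
by near: t; apply: cvgr_dist_le => //; rewrite divr_gt0.
Unshelve. all: by end_near. Qed.

(** For functions with a common Lipschitz constant, closeness at s gives closeness
near s; compactness of [-r,0] then makes do with finitely many points s. *)
Lemma near_lip_ball_supnorm (R : realType) n (r M Lam d : R) (g : {ptws R -> 'rV[R]_n}) :
  0 <= r -> 0 <= Lam -> 0 < d -> lip_ball M Lam g ->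
  \forall h \near g, lip_ball M Lam h -> supnorm r (h \- g) <= d.
Proof.
move=> r0 Lam0 d0 [_ gL].
have L1 : 0 < 2 * Lam + 1 by lra.
have near_eval s : \forall h \near g, enorm (h s - g s) < d / 2.
  have c : continuous (fun h : {ptws R -> 'rV[R]_n} => enorm (h s - g s)).
    move=> h; apply: continuous_comp; last exact: enorm_continuous.
    by apply: continuousB; [exact: eval_continuous|exact: cst_continuous].
  apply: (cvgr_lt _ (c g)) => //=.
  by rewrite subrr enorm0 divr_gt0.
suff : \forall h \near g,
    `[- r, 0] `<=` [set s | lip_ball M Lam h -> enorm (h s - g s) <= d].
  apply: filterS => h hs hK; apply: supnorm_le => // s rs.
  by apply: hs => //=; rewrite in_itv.
have /compact_near_coveringP ncov := @segment_compact R (- r) 0.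
apply: (ncov _ (nbhs g) (fun h s => lip_ball M Lam h -> enorm (h s - g s) <= d)
  (nbhs_filter g)) => s _; near=> t h => /= -[_ hL].
have hgs : enorm (h s - g s) < d / 2 by near: h; exact: near_eval.
have ts : `|s - t| <= d / 2 / (2 * Lam + 1).
  by near: t; apply: cvgr_dist_le => //; rewrite !divr_gt0.
have tsL : (2 * Lam + 1) * `|s - t| <= d / 2 by rewrite mulrC -ler_pdivlMr.
have -> : h t - g t = (h t - h s) + (h s - g s) + (g s - g t).
  by rewrite [_ + (h s - g s)]addrA subrK addrA subrK.
apply: le_trans (ler_enormD _ _) _; apply: le_trans (lerD (ler_enormD _ _) (lexx _)) _.
have := hL t s; have := gL s t; rewrite (distrC t s).
have := normr_ge0 (s - t); lra.
Unshelve. all: by end_near. Qed.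

(** * Uniform attraction *)

Lemma supnorm_leD (R : realType) n (r : R) (x y : R -> 'rV[R]_n) :
  0 <= r -> C0 r x -> C0 r y -> supnorm r x <= supnorm r (x \- y) + supnorm r y.
Proof.
move=> r0 cx cy; apply: supnorm_le => // s rs; rewrite -[x s](subrK (y s)).
apply: le_trans (ler_enormD _ _) _; apply: lerD; last exact: enorm_le_supnorm.
by apply: (@enorm_le_supnorm _ _ _ (x \- y)) => //; exact: C0B.
Qed.

(** Composing with this retraction of the line onto [-r,0] extends a Lipschitz
function on [-r,0] to the whole line with the same constant. *)
Definition clamp {R : realType} (r s : R) : R := Num.max (- r) (Num.min s 0).

Lemma clamp_itv (R : realType) (r s : R) : 0 <= r -> - r <= clamp r s <= 0.
Proof.
move=> r0; rewrite /clamp le_max lexx/= ge_max oppr_le0 r0/=.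
by rewrite ge_min lexx orbT.
Qed.

Lemma clamp_id (R : realType) (r s : R) : - r <= s <= 0 -> clamp r s = s.
Proof. by move=> /andP[rs s0]; rewrite /clamp min_l// max_r. Qed.

Lemma clamp_lipschitz (R : realType) (r s t : R) :
  `|clamp r s - clamp r t| <= `|s - t|.
Proof.
rewrite ler_norml; have st := ler_norm (s - t); have ts := lerNnormlW (lexx `|s - t|).
rewrite /clamp; have [s0|s0] := leP s 0; have [t0|t0] := leP t 0;
  have [rs|rs] := leP (- r) s; have [rt|rt] := leP (- r) t;
  have [r0|r0] := leP (- r) 0; apply/andP; split; lra.
Qed.

(** Compactness is used in the form of [near_covering], along times tending to
+oo: what holds for (h, T) near (g, +oo), for each g of the compact set, holds
for all h of the set at once when T is large. *)
Lemma uniform_attraction (R : realType) n (r : R) (f : (R -> 'rV[R]_n) -> 'rV[R]_n) :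
  0 < r -> f (fun _ => 0) = 0 -> lipschitz_on_bounded r f -> bounded_reach r f ->
  LS r f -> GA r f -> forall rho eps : R, 0 < eps ->
  exists2 T, 0 <= T & forall t x0, T <= t -> C0 r x0 -> supnorm r x0 <= rho ->
    supnorm r (phi r f t x0) <= eps.
Proof.
move=> r_gt0 f0 flip br ls ga rho eps eps0; have r0 := ltW r_gt0.
have [delta delta0 [_ /phi_norms_le stab]] := ls _ eps0.
have [M [Lam [M0 Lam0 reg]]] := phi_regularity r0 f0 flip br rho.
have lipM (h : {ptws R -> 'rV[R]_n}) : lip_ball M Lam h -> supnorm r h <= M.
  by move=> [hM _]; apply: supnorm_le.
have : \forall T \near +oo, lip_ball M Lam `<=` [set h | lip_ball M Lam h ->
    forall t, T <= t -> supnorm r (phi r f t h) <= eps].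
  have /compact_near_coveringP ncov := @compact_lip_ball R n M Lam.
  apply: ncov => g gK; have cg := lip_ball_C0 (r := r) Lam0 gK.
  (* At time Tg the orbit of g is halfway inside the stability ball, which
     leaves room delta / 2 for its neighbours. *)
  have [Tg [Tg0 gTg]] : exists Tg, 0 <= Tg /\ supnorm r (phi r f Tg g) <= delta / 2.
    apply: (@filter_ex _ (+oo : set_system R)).
    near=> t; split; first by near: t; exact: nbhs_pinfty_ge (num_real _).
    near: t; have gcvg := (ga g cg).2.
    by apply: (@cvgr_le _ _ _ _ _ 0 gcvg); rewrite divr_gt0.
  have [C C0' phiC] := phi_lipschitz r0 f0 flip br M Tg.
  have d0 : 0 < delta / 2 / (C + 1) by rewrite !divr_gt0// ltr_wpDl.
  near=> h T => /= hK t Tt; have ch := lip_ball_C0 (r := r) Lam0 hK.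
  have TgT : Tg <= T by near: T; exact: nbhs_pinfty_ge (num_real _).
  have hg : supnorm r (h \- g) <= delta / 2 / (C + 1).
    by move: hK; near: h; exact: near_lip_ball_supnorm.
  have Tgt : 0 <= t - Tg by rewrite subr_ge0 (le_trans TgT).
  have cphi x : C0 r x -> C0 r (phi r f Tg x) by move=> ?; exact: C0_phi.
  rewrite -(subrKC Tg t) (phi_semigroup r0 f0 flip br ch (cphi _ ch) Tg0 Tgt)//.
  apply: stab => //; first exact: cphi.
  apply: le_trans (supnorm_leD r0 (cphi _ ch) (cphi _ cg)) _.
  have Tg1 : 0 <= Tg <= Tg by rewrite Tg0 lexx.
  have := phiC h g Tg ch cg (lipM _ hK) (lipM _ gK) Tg1.
  have : C * supnorm r (h \- g) <= delta / 2.
    apply: (@le_trans _ _ ((C + 1) * supnorm r (h \- g))).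
      by rewrite ler_wpM2r ?lerDl// supnorm_ge0//; exact: C0B.
    by rewrite mulrC -ler_pdivlMr// ltr_wpDl.
  lra.
move=> nearT.
have [T [T0 TK]] := filter_ex (filterI (nbhs_pinfty_ge (num_real 0)) nearT).
exists (r + T); first by rewrite addr_ge0.
move=> t x0 Tt cx x0rho; have [regM regL] := reg _ cx x0rho.
(* Time r is spent on entering the compact set. *)
pose h := phi r f r x0 \o clamp r.
have hK : lip_ball M Lam h.
  split=> [s|s s']; first by apply: regM; exact: clamp_itv.
  apply: le_trans (regL _ _ (clamp_itv _ r0) (clamp_itv _ r0)) _.
  by rewrite ler_wpM2l// clamp_lipschitz.
have tr0 : 0 <= t - r by lra.
rewrite -(subrKC r t) (phi_semigroup (y0 := h) r0 f0 flip br cx _ r0 tr0).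
- by apply: TK => //; lra.
- exact: lip_ball_C0 Lam0 hK.
- by move=> u ru; rewrite /h/= clamp_id.
Unshelve. all: by end_near. Qed.

(** * Construction of a class-KL bound *)

(** For s > 0, and as a function of u >= 0, a continuous cut-off: 1 up to s, 0 from
2 s on, affine in between.  Dividing last, with 0^-1 = 0, makes it vanish for
s = 0, which a cut-off of 2 - u / s would not do. *)
Definition tent {R : realType} (s u : R) : R := Num.max 0 (Num.min s (2 * s - u)) / s.

Lemma tent0 (R : realType) (u : R) : tent 0 u = 0.
Proof. by rewrite /tent invr0 mulr0. Qed.

Lemma tentE (R : realType) (s u : R) : 0 < s ->
  tent s u = Num.max 0 (Num.min 1 (2 - u / s)).
Proof.
move=> s0; have si0 : 0 <= s^-1 by rewrite invr_ge0 ltW.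
by rewrite /tent maxr_pMl// minr_pMl// mul0r mulrBl divff ?gt_eqF// mulfK ?gt_eqF.
Qed.

Lemma tent_itv (R : realType) (s u : R) : 0 <= s -> 0 <= tent s u <= 1.
Proof.
rewrite le_eqVlt => /predU1P[<-|s0]; first by rewrite tent0 lexx ler01.
by rewrite tentE// le_max lexx/= ge_max ler01/= ge_min lexx.
Qed.

Lemma tent_out (R : realType) (s u : R) : 0 <= s -> 2 * s <= u -> tent s u = 0.
Proof.
rewrite le_eqVlt => /predU1P[<-|s0 su]; first by rewrite tent0.
rewrite tentE// max_l// ge_min; apply/orP; right.
by rewrite subr_le0 ler_pdivlMr.
Qed.

Lemma tent_diag (R : realType) (s : R) : 0 < s -> tent s s = 1.
Proof.
move=> s0; rewrite tentE// divff ?gt_eqF// (_ : 2 - 1 = 1); last by ring.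
by rewrite minxx max_r.
Qed.

Lemma tent_le (R : realType) (s s' u : R) : 0 <= u -> 0 <= s -> s <= s' ->
  tent s u <= tent s' u.
Proof.
move=> u0; rewrite le_eqVlt => /predU1P[<- s'0|s0 ss'].
  by rewrite tent0; have /andP[] := tent_itv u s'0.
have s'0 := lt_le_trans s0 ss'.
rewrite !tentE//; apply: le_max2 => //; apply: le_min2 => //.
by rewrite lerD2l lerN2 ler_wpM2l// lef_pV2.
Qed.

(** On [c/2, 2 c] the map s |-> u / s has Lipschitz constant u / (c/2)^2, at most
16 / c when u <= 4 c. *)
Lemma tent_lipschitz (R : realType) (c s s' u : R) : 0 < c -> c / 2 <= s <= 2 * c ->
  c / 2 <= s' <= 2 * c -> 0 <= u <= 4 * c ->
  tent s u <= tent s' u + 16 / c * `|s - s'|.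
Proof.
move=> c0 sc s'c uc; have s0 : 0 < s by lra.
have s'0 : 0 < s' by lra.
have : u / s' - u / s <= 16 / c * `|s - s'|.
  rewrite (_ : u / s' - u / s = u / (s * s') * (s - s')); last first.
    by field; rewrite !gt_eqF.
  apply: le_trans (ler_norm _) _; rewrite normrM ler_wpM2r//.
  rewrite ger0_norm; last by rewrite divr_ge0//; [lra|rewrite mulr_ge0 ?ltW].
  rewrite ler_pdivrMr ?mulr_gt0//.
  apply: (@le_trans _ _ (16 / c * (c / 2 * (c / 2)))).
    by rewrite (_ : 16 / c * _ = 4 * c); [lra|field; rewrite gt_eqF].
  rewrite ler_pM2l ?divr_gt0// ler_pM//; lra.
have : 0 <= 16 / c * `|s - s'| by rewrite mulr_ge0// divr_ge0// ltW.
rewrite !tentE//; move: (u / s) (u / s') (16 / c * _) => v v' d d0 vd.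
have [v1|v1] := leP 1 (2 - v); have [v1'|v1'] := leP 1 (2 - v');
  have [|] := leP 0 (2 - v); have [|] := leP 0 (2 - v'); have [|] := @leP _ R 0 1; lra.
Qed.

(** The bare supremum of a tau x over tau >= t and N x <= s has all the required
monotonicity and limits, but need not be continuous in s.  Weighting by
[tent s (N x)] makes the supremum locally Lipschitz in s > 0, while keeping it
between the bare suprema for s and for 2 s.  Adding s exp(-t) makes it
strictly increasing. *)
Lemma KL_majorant (R : realType) (X : Type) (A : set X) (N : X -> R) (a : R -> X -> R) :
  A !=set0 -> (forall x, A x -> 0 <= N x) ->
  (forall t x, 0 <= t -> A x -> 0 <= a t x) ->
  (forall eps, 0 < eps -> exists2 delta, 0 < delta &
     forall t x, 0 <= t -> A x -> N x <= delta -> a t x <= eps) ->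
  (forall rho, exists B, forall t x, 0 <= t -> A x -> N x <= rho -> a t x <= B) ->
  (forall rho eps, 0 < eps -> exists2 T, 0 <= T &
     forall t x, T <= t -> A x -> N x <= rho -> a t x <= eps) ->
  exists2 sigma, classKL sigma & forall t x, 0 <= t -> A x -> a t x <= sigma (N x) t.
Proof.
move=> [xA AxA] N0 a0 stab bnd attr.
pose S s t := [set y | exists tau x, [/\ t <= tau, A x & y = a tau x * tent s (N x)]].
pose g s t := sup (S s t).
have elt_ge0 s t x : 0 <= s -> 0 <= t -> A x -> 0 <= a t x * tent s (N x).
  by move=> s0 t0 Ax; rewrite mulr_ge0 ?a0//; have /andP[] := tent_itv (N x) s0.
have elt_le s t x e : 0 <= s -> 0 <= t -> A x -> 0 <= e -> (N x <= 2 * s -> a t x <= e) ->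
    a t x * tent s (N x) <= e.
  move=> s0 t0 Ax e0 ae; have [Ns|Ns] := leP (N x) (2 * s); last first.
    by rewrite tent_out ?mulr0// ltW.
  have /andP[w0 w1] := tent_itv (N x) s0.
  by apply: le_trans (ae Ns); rewrite ler_piMr// a0.
have S_bnd s t : 0 <= s -> 0 <= t -> has_ubound (S s t).
  move=> s0 t0; have [B aB] := bnd (2 * s).
  exists `|B| => _ [tau [x [ttau Ax ->]]].
  apply: elt_le => //; first exact: le_trans ttau.
  move=> Ns; apply: le_trans (ler_norm B); apply: aB => //; exact: le_trans ttau.
have g_ge s t tau x : 0 <= s -> 0 <= t -> t <= tau -> A x ->
    a tau x * tent s (N x) <= g s t.
  by move=> s0 t0 ttau Ax; apply: ub_le_sup; [exact: S_bnd|exists tau, x].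
have g_le s t c : (forall tau x, t <= tau -> A x -> a tau x * tent s (N x) <= c) ->
    g s t <= c.
  move=> Sc; apply: ge_sup; first by exists (a t xA * tent s (N xA)), t, xA.
  by move=> _ [tau [x [ttau Ax ->]]]; exact: Sc.
(* Terms with N x > 2 s have weight 0. *)
have g_small s t e : 0 <= s -> 0 <= t -> 0 <= e ->
    (forall tau x, t <= tau -> A x -> N x <= 2 * s -> a tau x <= e) -> g s t <= e.
  move=> s0 t0 e0 ae; apply: g_le => tau x ttau Ax.
  by apply: elt_le => //; [exact: le_trans ttau|exact: ae].
have g_ge0 s t : 0 <= s -> 0 <= t -> 0 <= g s t.
  by move=> s0 t0; apply: le_trans (g_ge s t t xA _ _ _ _) => //; exact: elt_ge0.
have g0 t : 0 <= t -> g 0 t = 0.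
  move=> t0; apply/eqP; rewrite eq_le g_ge0// andbT.
  by apply: g_le => tau x _ _; rewrite tent0 mulr0.
have g_mono s s' t : 0 <= s -> s <= s' -> 0 <= t -> g s t <= g s' t.
  move=> s0 ss' t0; have s'0 := le_trans s0 ss'.
  apply: g_le => tau x ttau Ax; apply: le_trans (g_ge s' t tau x s'0 t0 ttau Ax).
  by rewrite ler_wpM2l ?tent_le ?N0// a0//; exact: le_trans ttau.
have g_anti s t t' : 0 <= s -> 0 <= t -> t <= t' -> g s t' <= g s t.
  move=> s0 t0 tt'; apply: g_le => tau x ttau Ax; apply: g_ge => //.
  exact: le_trans ttau.
have g_lip t c : 0 <= t -> 0 < c -> exists2 K, 0 <= K & forall s s',
    c / 2 <= s <= 2 * c -> c / 2 <= s' <= 2 * c -> g s t <= g s' t + K * `|s - s'|.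
  move=> t0 c0; have [B aB] := bnd (4 * c).
  exists (`|B| * (16 / c)); first by rewrite mulr_ge0// divr_ge0// ltW.
  move=> s s' sc s'c; have s0 : 0 <= s by lra.
  have s'0 : 0 <= s' by lra.
  apply: g_le => tau x ttau Ax; have tau0 := le_trans t0 ttau.
  have gx := g_ge s' t tau x s'0 t0 ttau Ax.
  have [Nc|Nc] := leP (N x) (4 * c); last first.
    rewrite tent_out//; last by lra.
    by rewrite mulr0 addr_ge0 ?g_ge0// mulr_ge0// mulr_ge0// divr_ge0// ltW.
  have Nc' : 0 <= N x <= 4 * c by rewrite N0.
  apply: le_trans (ler_wpM2l (a0 _ _ tau0 Ax) (tent_lipschitz c0 sc s'c Nc')) _.
  rewrite mulrDr lerD// -[leRHS]mulrA ler_wpM2r//.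
    by rewrite mulr_ge0// divr_ge0// ltW.
  by apply: le_trans (ler_norm B); exact: aB.
have g_cont t : 0 <= t -> {within [set s | 0 <= s], continuous (g ^~ t)}.
  move=> t0; apply/subspace_continuousP => s /=; rewrite /from_subspace/=.
  rewrite le_eqVlt => /predU1P[<-|s0]; last first.
    apply: cvg_within_filter; apply/cvgrPdist_le => e e0.
    have [K K0 gK] := g_lip t s t0 s0.
    have K1 : 0 < K + 1 by rewrite ltr_wpDl.
    near=> s'.
    have ss' : `|s - s'| <= s / 2.
      by near: s'; apply: cvgr_dist_le => //; rewrite divr_gt0.
    have ss'e : `|s - s'| <= e / (K + 1).
      by near: s'; apply: cvgr_dist_le => //; rewrite divr_gt0.
    have sI : s / 2 <= s <= 2 * s by apply/andP; split; lra.
    have s'I : s / 2 <= s' <= 2 * s by move: ss'; rewrite ler_norml => /andP[? ?]; apply/andP; split; lra.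
    have Ke : K * `|s - s'| <= e.
      apply: (@le_trans _ _ ((K + 1) * `|s - s'|)).
        by rewrite ler_wpM2r// lerDl.
      by rewrite mulrC -ler_pdivlMr.
    have := gK _ _ sI s'I; have := gK _ _ s'I sI; rewrite (distrC s' s) ler_norml/=.
    by move=> ? ?; apply/andP; split; lra.
  (* Continuity at s = 0 is the stability hypothesis. *)
  rewrite g0//; apply/cvgrPdist_le => e e0.
  have [d d0 ad] := stab _ e0.
  rewrite near_withinE; near=> s' => s'0; rewrite sub0r normrN ger0_norm ?g_ge0//.
  apply: g_small => //; first exact: ltW.
  move=> tau x ttau Ax Ns; apply: ad => //; first exact: le_trans ttau.
  apply: le_trans Ns _; rewrite mulrC -ler_pdivlMr//.
  by near: s'; apply: (@cvgr_le _ _ (nbhs 0) _ id 0 cvg_id); rewrite divr_gt0.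
exists (fun s t => g s t + s * expR (- t)).
  split=> [t t0|s s0 t t' t0 tt'|s s0].
  - split=> [s s0||s s' s0 ss'|].
    + by rewrite addr_ge0 ?g_ge0// mulr_ge0 ?expR_ge0.
    + apply: within_continuousD; first exact: g_cont.
      apply: continuous_subspaceT; exact: mulrr_continuous.
    + apply: ler_ltD; first by apply: g_mono => //; exact: ltW.
      by rewrite ltr_pM2r ?expR_gt0.
    + by rewrite g0// mul0r addr0.
  - by rewrite lerD ?g_anti// ler_wpM2l// ler_expR lerN2.
  - rewrite -[X in _ --> X]addr0; apply: cvgD; last first.
      by rewrite -(mulr0 s); apply: cvgMr; exact: cvgr_expR.
    apply/cvgrPdist_le => e e0; have [T T0 aT] := attr (2 * s) _ e0.
    near=> t; have Tt : T <= t by near: t; exact: nbhs_pinfty_ge (num_real _).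
    have t0 := le_trans T0 Tt; rewrite sub0r normrN ger0_norm ?g_ge0//.
    apply: g_small => //; first exact: ltW.
    by move=> tau x ttau; apply: aT; exact: le_trans ttau.
move=> t x t0 Ax; have := N0 _ Ax; rewrite le_eqVlt => /predU1P[Nx|Nx].
  rewrite -Nx g0// mul0r addr0; apply/ler_addgt0Pl => e e0; rewrite addr0.
  by have [d d0 ad] := stab _ e0; apply: ad => //; rewrite -Nx ltW.
apply: (@le_trans _ _ (g (N x) t)); last by rewrite lerDl mulr_ge0 ?expR_ge0// ltW.
by rewrite -[leLHS]mulr1 -(tent_diag Nx); apply: g_ge => //; exact: ltW.
Unshelve. all: by end_near. Qed.

(** * The equivalence *)

Lemma GAS_RFC_UGAS (R : realType) n (r : R) (f : (R -> 'rV[R]_n) -> 'rV[R]_n) :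
  0 < r -> f (fun _ => 0) = 0 -> lipschitz_on_bounded r f ->
  GAS r f -> RFC r f -> UGAS r f.
Proof.
move=> r_gt0 f0 flip [ls ga] /RFC_bounded_reach br; have r0 := ltW r_gt0.
have attr := uniform_attraction r_gt0 f0 flip br ls ga.
have [|||||| sigma sigmaKL phi_le] := @KL_majorant R (R -> 'rV[R]_n) (C0 r)
  (supnorm r) (fun t x => supnorm r (phi r f t x)).
- by exists (fun=> 0); apply: continuous_subspaceT; exact: cst_continuous.
- by move=> x; exact: supnorm_ge0.
- by move=> t x t0 cx; apply: supnorm_ge0 => //; exact: C0_phi.
- move=> eps /ls[delta delta0 [_ /phi_norms_le stab]]; exists delta => //.
(* Boundedness for all times: attraction into the unit ball after T, and
   bounded reachability before. *)
- move=> rho; have [T T0 phi1] := attr rho 1 ltr01.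
  have [M M0 reachM] := br rho T.
  exists (M + 1) => t x t0 cx xrho; have [tT|tT] := leP t T.
    have /(_ t x) := reachM; rewrite t0 tT => /(_ isT cx xrho)[_]; lra.
  by have := phi1 t x (ltW tT) cx xrho; lra.
- by move=> rho eps /(attr rho)[T T0 phi_eps]; exists T.
exists sigma => // t x t0 cx; split; last exact: phi_le.
exact: bounded_reach_global br cx _ t0.
Qed.

Lemma classK_le (R : realType) (rho : R -> R) : classK rho ->
  forall s s', 0 <= s -> s <= s' -> rho s <= rho s'.
Proof.
move=> [_ _ rho_lt _] s s' s0; rewrite le_eqVlt => /predU1P[->//|ss'].
exact/ltW/rho_lt.
Qed.

Lemma UGAS_GAS_RFC (R : realType) n (r : R) (f : (R -> 'rV[R]_n) -> 'rV[R]_n) :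
  0 <= r -> UGAS r f -> GAS r f /\ RFC r f.
Proof.
move=> r0 [sigma [sigmaK sigma_anti sigma_cvg] ugas].
have sigma0 := sigmaK 0 (lexx 0).
have bound t x rho : 0 <= t -> C0 r x -> supnorm r x <= rho ->
    supnorm r (phi r f t x) <= sigma rho 0.
  move=> t0 cx xrho; have x0 := supnorm_ge0 r0 cx.
  apply: le_trans (ugas t x t0 cx).2 _; apply: (@le_trans _ _ (sigma (supnorm r x) 0)).
    by apply: sigma_anti.
  exact: classK_le sigma0 _ _ x0 xrho.
split; [split|].
- move=> eps eps0; have [_ /subspace_continuousP /(_ 0 (lexx 0)) c0 _ s00] := sigma0.
  have [delta [delta0 sdelta]] : exists delta, 0 < delta /\ sigma delta 0 <= eps.
    have : \forall d \near within [set s | 0 <= s] (nbhs (0 : R)), sigma d 0 <= eps.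
      by apply: (@cvgr_le _ _ _ _ _ _ c0); rewrite /from_subspace/= s00.
    rewrite near_withinE => /nbhs_ballP[e /= e0 be].
    exists (e / 2); rewrite divr_gt0//; split=> //; apply: be; last by rewrite /= divr_ge0// ltW.
    rewrite /ball/= sub0r normrN gtr0_norm ?divr_gt0//; lra.
  exists delta => //; split; first by move=> t x t0 cx _; exact: (ugas t x t0 cx).1.
  apply: ge_ereal_sup => _ [t [x [t0 cx xd ->]]].
  by rewrite lee_fin; apply: le_trans (bound _ _ _ t0 cx xd) _.
- move=> x cx; split; first by move=> t t0; exact: (ugas t x t0 cx).1.
  have x0 := supnorm_ge0 r0 cx.
  apply: (squeeze_cvgr _ (cvg_cst 0) (sigma_cvg _ x0)).
  near=> t; have t0 : 0 <= t by near: t; exact: nbhs_pinfty_ge.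
  have [ex ->] := ugas t x t0 cx; rewrite andbT.
  have [traj _] := max_sol_trajectory (fun u u0 => (ugas u x u0 cx).1).
  by apply: supnorm_ge0 => //; apply: C0_segment (traj t).1 _; rewrite t0 lexx.
- move=> rho T rho0 T0; split.
    by move=> t x /andP[t0 _] cx _; exact: (ugas t x t0 cx).1.
  apply: (@le_lt_trans _ _ (sigma rho 0)%:E); last exact: ltry.
  apply: ge_ereal_sup => _ [t [x [/andP[t0 _] cx xd ->]]].
  by rewrite lee_fin; exact: bound.
Unshelve. all: by end_near. Qed.

Theorem theorem1 (R : realType) (n : nat) (r : R)
    (f : (R -> 'rV[R]_n) -> 'rV[R]_n)
    (r_gt0 : 0 < r)
    (f0 : f (fun _ => 0) = 0)
    (f_lip : lipschitz_on_bounded r f) :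
  (GAS r f /\ RFC r f) <-> UGAS r f.
Proof.
split=> [[gas rfc]|]; first exact: GAS_RFC_UGAS.
by apply: UGAS_GAS_RFC; exact: ltW.
Qed.
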